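(* Let $N\ge 1$ be an integer, let $(\Omega,\mathcal{A},\mu)$ be a submodular capacity space and let $F:[0,1]^{N}\to L^{0}(\Omega,\mathcal{A},\mu)$ be a random function which is continuous in capacity at each point $\mathbf{x}\in[0,1]^{N}$. Suppose that there are a finite constant $M$ and a set $E\in\mathcal{A}$ with $\mu(E)=0$ such that $\sup_{\mathbf{x}\in[0,1]^{N}}|F(\mathbf{x},\omega)|\le M$ for all $\omega\in\Omega\setminus E$. Then the random Bernstein polynomials $B_{n_{1},\dots,n_{N}}(F)$ converge uniformly to $F$ in capacity as $\min\{n_{1},\dots,n_{N}\}\to\infty$; that is, for all $\varepsilon,\eta>0$ there is $n_{0}\in\mathbb{N}$ such that $$\mu\left(\{\omega\in\Omega:|B_{n_{1},\dots,n_{N}}(F)(\mathbf{x},\omega)-F(\mathbf{x},\omega)|\ge\varepsilon\}\right)<\eta$$ for all $\mathbf{x}\in[0,1]^{N}$ and all $n_{1},\dots,n_{N}\ge n_{0}$.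
   Context: Capacity. Let $\mathcal{A}$ be a $\sigma$-algebra of subsets of a nonempty set $\Omega$. A capacity is a set function $\mu:\mathcal{A}\to\mathbb{R}_{+}$ with $\mu(\emptyset)=0$, $\mu(\Omega)=1$ and $\mu(A)\le\mu(B)$ whenever $A\subset B$, $A,B\in\mathcal{A}$. It is submodular if $\mu(A\cup B)+\mu(A\cap B)\le\mu(A)+\mu(B)$ for all $A,B\in\mathcal{A}$. A submodular capacity space is a triple $(\Omega,\mathcal{A},\mu)$ with $\mu$ a submodular capacity. $L^{0}(\Omega,\mathcal{A},\mu)$ is the space of all $\mathcal{A}$-measurable functions $f:\Omega\to\mathbb{R}$. Random functions. A random function on $D\subset\mathbb{R}^{N}$ is a map $F:D\to L^{0}(\Omega,\mathcal{A},\mu)$; one writes $F(\mathbf{x},\omega)=F(\mathbf{x})(\omega)$. $F$ is continuous in capacity at $\mathbf{x}_{0}\in D$ if for all $\varepsilon,\eta>0$ there is $\delta>0$ such that $\mu(\{\omega\in\Omega:|F(\mathbf{x},\omega)-F(\mathbf{x}_{0},\omega)|\ge\varepsilon\})<\eta$ whenever $\mathbf{x}\in D$ and $\|\mathbf{x}-\mathbf{x}_{0}\|<\delta$. Random Bernstein polynomials. For positive integers $n_{1},\dots,n_{N}$, $$B_{n_{1},\dots,n_{N}}(F)(x_{1},\dots,x_{N},\omega)=\sum_{k_{1}=0}^{n_{1}}\cdots\sum_{k_{N}=0}^{n_{N}}p_{k_{1},n_{1}}(x_{1})\cdots p_{k_{N},n_{N}}(x_{N})\,F\left(\frac{k_{1}}{n_{1}},\dots,\frac{k_{N}}{n_{N}},\omega\right),$$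 where $p_{k,n}(x)=\binom{n}{k}x^{k}(1-x)^{n-k}$. *)

(* Defs.v *)
From HB Require Import structures.
From mathcomp Require Import all_boot all_order all_algebra.
From mathcomp Require Import all_classical all_reals all_analysis.
Set Implicit Arguments.
Unset Strict Implicit.
Unset Printing Implicit Defensive.
Import Order.TTheory GRing.Theory Num.Theory.
Import numFieldNormedType.Exports.
Local Open Scope classical_set_scope.
Local Open Scope ring_scope.

(* A set function is total on [set T]; only its values on measurable sets are
   constrained.  Nonemptiness of [T] follows from [mu set0 <> mu setT]. *)
Record capacity (R : realType) (d : measure_display) (T : measurableType d)
    (mu : set T -> R) : Prop := Capacity {
  capacity_ge0 : forall A, measurable A -> 0 <= mu A;
  capacity_set0 : mu set0 = 0;
  capacity_setT : mu setT = 1;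
  capacity_le : forall A B, measurable A -> measurable B ->
    A `<=` B -> mu A <= mu B }.

Definition submodular (R : realType) (d : measure_display)
    (T : measurableType d) (mu : set T -> R) : Prop :=
  forall A B, measurable A -> measurable B ->
    mu (A `|` B) + mu (A `&` B) <= mu A + mu B.

(* The norm the library puts on ['rV[R]_N] is the sup norm. *)
Definition euclidean_norm (R : realType) (N : nat) (x : 'rV[R]_N) : R :=
  Num.sqrt (\sum_(i < N) x ord0 i ^+ 2).

Definition unit_cube (R : realType) (N : nat) : set 'rV[R]_N :=
  [set x | forall i, 0 <= x ord0 i <= 1].
Arguments unit_cube : clear implicits.

(* A random function on [D] is given by a total [F] whose values outside [D]
   are irrelevant. *)
Definition random_function (R : realType) (d : measure_display)
    (T : measurableType d) (N : nat) (D : set 'rV[R]_N)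
    (F : 'rV[R]_N -> T -> R) : Prop :=
  forall x, D x -> measurable_fun [set: T] (F x).

Definition continuous_in_capacity_at (R : realType) (d : measure_display)
    (T : measurableType d) (mu : set T -> R) (N : nat) (D : set 'rV[R]_N)
    (F : 'rV[R]_N -> T -> R) (x0 : 'rV[R]_N) : Prop :=
  forall eps eta : R, 0 < eps -> 0 < eta ->
    exists2 delta : R, 0 < delta &
      forall x, D x -> euclidean_norm (x - x0) < delta ->
        mu [set w | eps <= `|F x w - F x0 w|] < eta.

Definition bernstein_basis (R : realType) (k n : nat) (x : R) : R :=
  'C(n, k)%:R * x ^+ k * (1 - x) ^+ (n - k).

(* The iterated sum over 0 <= k_i <= n_i is written as one sum over the
   families k of indices k_i : 'I_(n_i + 1). *)
Definition random_bernstein (R : realType) (T : Type) (N : nat)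
    (n : 'I_N -> nat) (F : 'rV[R]_N -> T -> R) (x : 'rV[R]_N) (w : T) : R :=
  \sum_(k : {dffun forall i : 'I_N, 'I_(n i).+1})
    (\prod_(i < N) bernstein_basis (k i) (n i) (x ord0 i)) *
    F (\row_(i < N) ((k i)%:R / (n i)%:R)) w.

(* Main.v *)
Require Import Defs.
From HB Require Import structures.
From mathcomp Require Import all_boot all_order all_algebra.
From mathcomp Require Import all_classical all_reals all_analysis.
From mathcomp Require Import measurable_realfun ring lra.
Import Order.TTheory GRing.Theory Num.Theory.
Import numFieldNormedType.Exports.
Local Open Scope classical_set_scope.
Local Open Scope ring_scope.

(** Write [B_n F x = \sum_k p k * F (y k)], where the weights [p k >= 0] depend
    on [x], sum to [1] and concentrate around [x] on the grid points [y k].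
    Then [B_n F x - F x] is the average of the deviations [F (y k) - F x].
    Each of them is small in capacity when [y k] is close to [x], by uniform
    continuity in capacity on the compact cube.  The number of grid points grows with [n],
    so bounding the capacity of a union by the sum of the capacities is
    useless: the averages themselves have to be controlled.

    What makes this work is a Markov inequality for averages of indicators,
    [submodular_markov]: if at every point of [B] the sets [A k] containing it
    have total weight at least [c], then [c * mu B <= \sum_k p k * mu (A k)].
    For an additive [mu] this is integration of [\sum_k p k * 1_(A k)]; for a
    submodular one it is an instance of the subadditivity of the Choquet
    integral, proved here without any integral.  The set [B] is covered one
    piece at a time by intersections of the [A k] over index sets [s] of total
    weight at least [c]; by submodularity, a piece contained in [A k] enlarges the part
    of [A k] covered so far by at least as much capacity as it adds to the whole
    covered set.

    It is applied with [A k] the event that [F (y k)] and [F x] differ by at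
    least [eps / 2].  Outside [E] the deviations are at most [2 * L], where
    [L = `|M| + 1], so an average of size [eps] forces the [A k] that occur to
    have total weight at least [c = eps / (4 * L)].  On the other side,
    [\sum_k p k * mu (A k)] is small: the capacity [mu (A k)] is small for [y k]
    near [x] and at most [1] otherwise, and Chebyshev's argument bounds the
    weight of the far grid points through the variance of the weights, which is
    at most [N / min n].  *)

(** * A Markov inequality for submodular capacities *)

Section SubmodularCapacity.
Context {R : realType} {d : measure_display} {T : measurableType d}.
Context {mu : set T -> R}.
Hypotheses (mu_cap : capacity mu) (mu_sub : submodular mu).

Lemma capacity_le1 {A} : measurable A -> mu A <= 1.
Proof.
move=> mA; rewrite -(capacity_setT mu_cap).
exact: capacity_le mA measurableT (@subsetT _ A).
Qed.

Lemma submodular_capacityU {A B} : measurable A -> measurable B ->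
  mu (A `|` B) <= mu A + mu B.
Proof.
move=> mA mB; apply: le_trans (mu_sub _ _ mA mB).
by rewrite lerDl; apply: (capacity_ge0 mu_cap); exact: measurableI.
Qed.

(** Diminishing returns: since [C] lies in [A], it is added on the right to the
    smaller set [A `&` S], where it counts at least as much as when added to
    [S].  This is submodularity for the pair [A `&` (C `|` S)] and [S]. *)
Lemma submodular_increment {A S C} : measurable A -> measurable S ->
  measurable C -> C `<=` A ->
  mu (C `|` S) - mu S <= mu (A `&` (C `|` S)) - mu (A `&` S).
Proof.
move=> mA mS mC CA; rewrite lerBlDr addrAC lerBrDr.
have mCS : measurable (C `|` S) by exact: measurableU.
have := mu_sub _ _ (measurableI _ _ mA mCS) mS.
have -> : A `&` (C `|` S) `|` S = C `|` S.
  apply/seteqP; split=> [w [[_]|]|w [Cw|Sw]]; [by []|by right| |by right].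
  by left; split; [exact: CA|left].
have -> : A `&` (C `|` S) `&` S = A `&` S.
  by rewrite -setIA; congr (A `&` _); apply/setIidPr => w; right.
by [].
Qed.

(** The induction behind [submodular_markov].  When the piece [C s] is added to
    the covered set [S], the capacity of the covered part of [A k] grows by at
    least the increment [mu (C s `|` S) - mu S] for each [k] in [s], and does
    not decrease for the others; the indices in [s] weigh at least [c] together,
    so the weighted sum grows at least [c] times as fast as [mu S]. *)
Lemma submodular_layers {K : finType} {p : K -> R} {A : K -> set T} {c : R}
    {C : {set K} -> set T} {ss : seq {set K}} :
  (forall k, 0 <= p k) -> (forall k, measurable (A k)) ->
  (forall s, measurable (C s)) ->
  (forall (s : {set K}) k, k \in s -> C s `<=` A k) ->
  {in ss, forall s : {set K}, c <= \sum_(k in s) p k} ->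
  c * mu (\big[setU/set0]_(s <- ss) C s) <=
  \sum_k p k * mu (A k `&` \big[setU/set0]_(s <- ss) C s).
Proof.
move=> p0 mA mC CA; elim: ss => [|s ss IH] hc.
  rewrite big_nil (capacity_set0 mu_cap) mulr0 sumr_ge0// => k _.
  by rewrite setI0 (capacity_set0 mu_cap) mulr0.
rewrite big_cons; set S := \big[_/_]_(_ <- ss) _ in IH *.
have mS : measurable S by exact: bigsetU_measurable.
have mCS : measurable (C s `|` S) by exact: measurableU.
have {}IH : c * mu S <= \sum_k p k * mu (A k `&` S).
  by apply: IH => t ht; apply: hc; rewrite in_cons ht orbT.
have cs : c <= \sum_(k in s) p k by apply: hc; rewrite mem_head.
have incr0 : 0 <= mu (C s `|` S) - mu S.
  by rewrite subr_ge0; apply: (capacity_le mu_cap) => // w; right.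
apply: (@le_trans _ _
    (\sum_k (p k * mu (A k `&` S) +
             (k \in s)%:R * p k * (mu (C s `|` S) - mu S)))).
  rewrite big_split/= -[X in X <= _](subrK (c * mu S)) addrC lerD// -mulrBr.
  rewrite -mulr_suml; apply: ler_wpM2r => //; apply: le_trans cs _.
  rewrite big_mkcond/=; apply: ler_sum => k _.
  by case: ifP; rewrite ?mul1r ?mul0r.
apply: ler_sum => k _; case ks : (k \in s); last first.
  rewrite !mul0r addr0; apply: ler_wpM2l => //.
  apply: (capacity_le mu_cap); [exact: measurableI|exact: measurableI|].
  by apply: setIS => w; right.
rewrite mul1r -mulrDr; apply: ler_wpM2l => //.
by rewrite addrC -lerBrDr; apply: submodular_increment => //; exact: CA.
Qed.

(** The pieces [C s] are the intersections of the [A k] over the index sets [s]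
    of weight at least [c]; a point [w] of [B] lies in the piece indexed by
    all the [k] with [w \in A k]. *)
Lemma submodular_markov {K : finType} {p : K -> R} {A : K -> set T}
    {B : set T} {c : R} :
  (forall k, 0 <= p k) -> (forall k, measurable (A k)) -> measurable B ->
  0 <= c -> (forall w, B w -> c <= \sum_(k | w \in A k) p k) ->
  c * mu B <= \sum_k p k * mu (A k).
Proof.
move=> p0 mA mB c0 hB.
pose C (s : {set K}) := \bigcap_(k in [set k | k \in s]) A k.
have mC s : measurable (C s).
  by apply: fin_bigcap_measurable => //; exact: finite_finset.
pose ss := [seq s : {set K} <- index_enum {set K} | c <= \sum_(k in s) p k].
have hss : {in ss, forall s : {set K}, c <= \sum_(k in s) p k}.
  by move=> s; rewrite mem_filter => /andP[].
have CA (s : {set K}) k : k \in s -> C s `<=` A k by move=> ks w; apply.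
have mS : measurable (\big[setU/set0]_(s <- ss) C s).
  exact: bigsetU_measurable.
have layers := submodular_layers p0 mA mC CA hss.
apply: le_trans (le_trans layers _).
  apply: ler_wpM2l => //; apply: (capacity_le mu_cap) => // w Bw.
  rewrite -bigcup_seq; exists [set k | w \in A k]%SET.
    rewrite /= mem_filter mem_index_enum andbT.
    by under eq_bigl do rewrite inE; exact: hB.
  by move=> k /=; rewrite inE => /set_mem.
apply: ler_sum => k _; apply: ler_wpM2l => //.
by apply: (capacity_le mu_cap) => //; exact: measurableI.
Qed.

End SubmodularCapacity.

(** * Uniform continuity in capacity on the cube *)

Section UniformContinuity.
Context {R : realType} {d : measure_display} {T : measurableType d}.
Context {mu : set T -> R} {N : nat} {F : 'rV[R]_N -> T -> R}.

Lemma measurable_deviation {f g : T -> R} (a : R) :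
  measurable_fun [set: T] f -> measurable_fun [set: T] g ->
  measurable [set w | a <= `|f w - g w|].
Proof.
move=> mf mg; rewrite -[X in measurable X]setTI; apply: measurable_fun_le => //.
by apply: measurableT_comp => //; exact: measurable_funB.
Qed.

Lemma unit_cube_compact : compact (unit_cube R N).
Proof.
have := @rV_compact R N (fun=> [set` `[0, 1]]) (fun=> @segment_compact R 0 1).
congr compact; apply/seteqP; split=> v hv i; have := hv i;
  by rewrite /= in_itv.
Qed.

(** With [N.+1] instead of the square root of [N] the factor is crude, but it is
    positive and gives a strict bound also for [N = 0]. *)
Lemma euclidean_norm_lt (x : 'rV[R]_N) (r : R) : 0 < r ->
  (forall i, `|x ord0 i| < r / N.+1%:R) -> euclidean_norm x < r.
Proof.
move=> r0 hx; have N10 : 0 < N.+1%:R :> R by rewrite ltr0n.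
have rN0 : 0 < r / N.+1%:R by rewrite divr_gt0.
rewrite /euclidean_norm -(ger0_norm (ltW r0)) -sqrtr_sqr ltr_sqrt ?exprn_gt0//.
apply: (@le_lt_trans _ _ (\sum_(i < N) (r / N.+1%:R) ^+ 2)).
  apply: ler_sum => i _; rewrite -real_normK ?num_real//.
  by apply: lerXn2r; rewrite ?nnegrE//; exact: ltW.
rewrite sumr_const card_ord -[ltLHS]mulr_natl.
have -> : r ^+ 2 = N.+1%:R ^+ 2 * (r / N.+1%:R) ^+ 2 by field; rewrite gt_eqF.
rewrite ltr_pM2r ?exprn_gt0// -natrX ltr_nat.
by rewrite expnS expn1 leq_pmull.
Qed.

(** Heine-Cantor: the triangle inequality for the deviations becomes
    subadditivity of [mu], at the cost of halving [eps] and [eta].  Closeness is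
    measured coordinatewise, so that no triangle inequality for the Euclidean
    norm is needed and a violation singles out one coordinate, as Chebyshev's
    argument wants. *)
Lemma continuous_in_capacity_uniformly :
  capacity mu -> submodular mu -> random_function (unit_cube R N) F ->
  (forall x, unit_cube R N x ->
     continuous_in_capacity_at mu (unit_cube R N) F x) ->
  forall eps eta : R, 0 < eps -> 0 < eta ->
  exists2 delta : R, 0 < delta &
    forall x y, unit_cube R N x -> unit_cube R N y ->
      (forall i, `|y ord0 i - x ord0 i| < delta) ->
      mu [set w | eps <= `|F y w - F x w|] < eta.
Proof.
move=> mu_cap mu_sub mF cF eps eta eps0 eta0.
pose P (r : R) (x : 'rV[R]_N) := unit_cube R N x -> forall y, unit_cube R N y ->
  (forall i, `|y ord0 i - x ord0 i| < r) ->
  mu [set w | eps <= `|F y w - F x w|] < eta.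
have : \forall r \near 0^'+, unit_cube R N `<=` P r.
  apply: (iffLR (compact_near_coveringP _) unit_cube_compact) => x0 cx0.
  have [dl dl0 hdl] := cF _ cx0 _ _
    (divr_gt0 eps0 (ltr0Sn R 1)) (divr_gt0 eta0 (ltr0Sn R 1)).
  (* Half of the radius is for the distance from [x] to [x0], half for the one
     from [y] to [x]; [euclidean_norm_lt] asks for the factor [N.+1]. *)
  pose r0 := dl / N.+1%:R / 2.
  have r00 : 0 < r0 by rewrite !divr_gt0.
  exists (ball x0 r0, [set r | r < r0]).
    by split; [exact: nbhsx_ballx|exact: nbhs_right_lt].
  move=> [x r]/= [bx rr0] cx y cy hy.
  have close z : unit_cube R N z ->
      (forall i, `|z ord0 i - x0 ord0 i| < dl / N.+1%:R) ->
      mu [set w | eps / 2 <= `|F z w - F x0 w|] < eta / 2.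
    move=> cz hz; apply: hdl => //; apply: euclidean_norm_lt => // i.
    by rewrite !mxE; exact: hz.
  have xx0 i : `|x ord0 i - x0 ord0 i| < r0.
    by have [_ /(_ ord0 i)] := bx; rewrite /ball/= distrC.
  have r02 : dl / N.+1%:R = r0 + r0 by rewrite /r0 -splitr.
  clearbody r0.
  have m1 := measurable_deviation (eps / 2) (mF _ cy) (mF _ cx0).
  have m2 := measurable_deviation (eps / 2) (mF _ cx) (mF _ cx0).
  have hyx0 : mu [set w | eps / 2 <= `|F y w - F x0 w|] < eta / 2.
    apply: close => // i; rewrite r02.
    have := hy i; have := xx0 i.
    have := ler_distD (x ord0 i) (y ord0 i) (x0 ord0 i).
    by move: rr0; lra.
  have hxx0 : mu [set w | eps / 2 <= `|F x w - F x0 w|] < eta / 2.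
    by apply: close => // i; rewrite r02; have := xx0 i; lra.
  rewrite [eta]splitr; apply: le_lt_trans (ltrD hyx0 hxx0).
  apply: le_trans (submodular_capacityU mu_cap mu_sub m1 m2).
  apply: (capacity_le mu_cap); [|exact: measurableU|].
    by apply: measurable_deviation; exact: mF.
  move=> w /= hw; have := ler_distD (F x0 w) (F y w) (F x w).
  rewrite [`|F x0 w - _|]distrC => tri.
  have [?|?] := leP (eps / 2) `|F y w - F x0 w|; [by left|right].
  by rewrite /=; lra.
move=> hnear; near (0 : R)^'+ => dl.
have hdl : unit_cube R N `<=` P dl by near: dl.
by exists dl => // x y cx cy; apply: hdl.
Unshelve. all: by end_near.
Qed.

End UniformContinuity.

(** * Moments of the Bernstein weights *)

Section BernsteinWeights.
Context {R : realType}.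

Lemma bernstein_basis_ge0 k n (x : R) : 0 <= x <= 1 ->
  0 <= bernstein_basis k n x.
Proof.
move=> /andP[x0 x1]; rewrite /bernstein_basis.
by rewrite !mulr_ge0 ?exprn_ge0 ?subr_ge0.
Qed.

Lemma bernstein_basis0 k (x : R) : bernstein_basis k 0 x = (k == 0%N)%:R.
Proof.
by rewrite /bernstein_basis bin0n; case: k => [|k]; rewrite ?mul0r// !mulr1.
Qed.

(** Conditioning on the last of [n.+1] Bernoulli trials, by Pascal's rule.  It
    yields the moments of the binomial law by induction on [n]. *)
Lemma sum_bernstein_basisS n (f : nat -> R) (x : R) :
  \sum_(k < n.+2) bernstein_basis k n.+1 x * f k =
  x * \sum_(k < n.+1) bernstein_basis k n x * f k.+1 +
  (1 - x) * \sum_(k < n.+1) bernstein_basis k n x * f k.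
Proof.
rewrite big_ord_recl/=.
under eq_bigr => i _.
  have -> : bernstein_basis (bump 0 i) n.+1 x * f (bump 0 i) =
    x * (bernstein_basis i n x * f i.+1) +
    (1 - x) * ('C(n, i.+1)%:R * x ^+ i.+1 * (1 - x) ^+ (n - i.+1) * f i.+1).
    rewrite /bump/= add1n /bernstein_basis subSS binS natrD.
    have [lt_in|] := ltnP i n; last first.
      by move=> ni; rewrite bin_small//= exprS; ring.
    by rewrite -(subnSK lt_in) !exprS; ring.
  over.
rewrite big_split/= -!mulr_sumr addrCA; congr (_ + _).
rewrite [in RHS]big_ord_recl big_ord_recr/= bin_small//.
rewrite !mul0r addr0 mulrDr; congr (_ + _).
  by rewrite /bernstein_basis !bin0 !subn0 exprS expr0 !mul1r mulrA.
Qed.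

Lemma sum_bernstein_basis n (x : R) :
  \sum_(k < n.+1) bernstein_basis k n x = 1.
Proof.
elim: n => [|n IH]; first by rewrite big_ord1 bernstein_basis0.
have := sum_bernstein_basisS n (fun=> 1) x.
under eq_bigr do rewrite mulr1.
under [in X in _ = X -> _]eq_bigr do rewrite mulr1.
by rewrite IH => ->; ring.
Qed.

(** The center [a] is arbitrary so that the induction goes through: a success
    in the last trial shifts it to [a - 1]. *)
Lemma bernstein_basis_moment2 n (x a : R) :
  \sum_(k < n.+1) bernstein_basis k n x * (k%:R - a) ^+ 2 =
  n%:R * (x * (1 - x)) + (n%:R * x - a) ^+ 2.
Proof.
elim: n a => [|n IH] a.
  by rewrite big_ord1 bernstein_basis0 eqxx /= mul1r; ring.
rewrite (sum_bernstein_basisS n (fun k => (k%:R - a) ^+ 2)) IH.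
have shift (k : nat) : k.+1%:R - a = k%:R - (a - 1) :> R.
  by rewrite -natr1; ring.
under eq_bigr => k _ do rewrite shift.
by rewrite IH -natr1; ring.
Qed.

Lemma bernstein_basis_variance n (x : R) : (0 < n)%N ->
  \sum_(k < n.+1) bernstein_basis k n x * (k%:R / n%:R - x) ^+ 2 =
  x * (1 - x) / n%:R.
Proof.
move=> n0; have n0' : n%:R != 0 :> R by rewrite pnatr_eq0 -lt0n.
transitivity ((n%:R ^+ 2)^-1 *
    \sum_(k < n.+1) bernstein_basis k n x * (k%:R - n%:R * x) ^+ 2).
  by rewrite mulr_sumr; apply: eq_bigr => k _; field.
by rewrite bernstein_basis_moment2; field.
Qed.

(** The expansion [bigA_distr_bigA] with an index type depending on the factor.
    The detour through tagged indices makes that type uniform. *)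
Lemma prod_sum_dffun {I : finType} {J : I -> finType} (f : forall i, J i -> R) :
  \prod_i \sum_j f i j =
  \sum_(k : {dffun forall i : I, J i}) \prod_i f i (k i).
Proof.
under eq_bigr do rewrite big_tag.
rewrite bigA_distr_big_dep (reindex _ (onW_bij _ (@dffun_of_fprod_bij I J))).
transitivity (\sum_(t : fprod J) \prod_i [ffun j => f i j] (t i)).
  rewrite big_fprod; apply: eq_bigr => g _; apply: eq_bigr => i _.
  by rewrite /untag; case: eqP => // e; rewrite ffunE.
by apply: eq_bigr => t _; apply: eq_bigr => i _; rewrite !ffunE.
Qed.

Definition bernstein_weight {N : nat} (n : 'I_N -> nat) (x : 'rV[R]_N)
    (k : {dffun forall i : 'I_N, 'I_(n i).+1}) : R :=
  \prod_(i < N) bernstein_basis (k i) (n i) (x ord0 i).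

Definition bernstein_node {N : nat} (n : 'I_N -> nat)
    (k : {dffun forall i : 'I_N, 'I_(n i).+1}) : 'rV[R]_N :=
  \row_(i < N) ((k i)%:R / (n i)%:R).

Context {N : nat} {n : 'I_N -> nat}.

Lemma bernstein_node_cube k : unit_cube R N (bernstein_node n k).
Proof.
move=> i; rewrite mxE; have := ltn_ord (k i); rewrite ltnS => kn.
have [n0|n0] := posnP (n i).
  by rewrite (_ : (n i)%:R = 0) ?n0// invr0 mulr0 lexx ler01.
by rewrite divr_ge0//= ler_pdivrMr ?ltr0n// mul1r ler_nat.
Qed.

Lemma bernstein_weight_ge0 x (k : {dffun forall i : 'I_N, 'I_(n i).+1}) :
  unit_cube R N x -> 0 <= bernstein_weight n x k.
Proof. by move=> cx; apply: prodr_ge0 => i _; exact: bernstein_basis_ge0. Qed.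

Lemma sum_bernstein_weight x : \sum_k bernstein_weight n x k = 1.
Proof.
rewrite -(prod_sum_dffun (fun i (j : 'I_(n i).+1) =>
  bernstein_basis j (n i) (x ord0 i))).
by apply: big1 => i _; exact: sum_bernstein_basis.
Qed.

(** The weights form a product law, so a function of one coordinate is averaged
    by the marginal: the other factors of the product of sums equal [1]. *)
Lemma bernstein_weight_marginal x (i0 : 'I_N) (g : 'I_(n i0).+1 -> R) :
  \sum_k bernstein_weight n x k * g (k i0) =
  \sum_(j < (n i0).+1) bernstein_basis j (n i0) (x ord0 i0) * g j.
Proof.
(* [g] is only defined on the indices of the coordinate [i0]; [h] extends it by
   [1] to the other coordinates, so that the summand becomes a product. *)
pose h i (j : 'I_(n i).+1) : R :=
  if @eqP _ i i0 is ReflectT e then g (ecast i _ e j) else 1.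
have hi0 j : h i0 j = g j.
  by rewrite /h; case: eqP => // e; rewrite (eq_irrelevance e erefl).
have hi i j : i != i0 -> h i j = 1 by rewrite /h; case: eqP.
transitivity (\sum_(k : {dffun forall i : 'I_N, 'I_(n i).+1}) \prod_i
   (bernstein_basis (k i) (n i) (x ord0 i) * h i (k i))).
  apply: eq_bigr => k _; rewrite big_split/=; congr (_ * _).
  by rewrite (bigD1 i0)//= hi0 big1 ?mulr1// => i; exact: hi.
rewrite -(prod_sum_dffun (fun i (j : 'I_(n i).+1) =>
  bernstein_basis j (n i) (x ord0 i) * h i j)) (bigD1 i0)//=.
rewrite [X in _ * X]big1 ?mulr1; first by apply: eq_bigr => j _; rewrite hi0.
move=> i ii0; under eq_bigr do rewrite hi// mulr1.
exact: sum_bernstein_basis.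
Qed.

Lemma bernstein_weight_variance x m :
  unit_cube R N x -> (0 < m)%N -> (forall i, (m <= n i)%N) ->
  \sum_k bernstein_weight n x k *
    (\sum_i (bernstein_node n k ord0 i - x ord0 i) ^+ 2) <=
  N%:R / m%:R.
Proof.
move=> cx m0 mn; under eq_bigr do rewrite mulr_sumr.
rewrite exchange_big/= -[N in N%:R]card_ord -sumr_const mulr_suml.
apply: ler_sum => i _.
under eq_bigr do rewrite mxE.
rewrite (bernstein_weight_marginal x i
  (fun j : 'I_(n i).+1 => ((j : nat)%:R / (n i)%:R - x ord0 i) ^+ 2)).
have ni0 : (0 < n i)%N by exact: leq_trans m0 (mn i).
rewrite bernstein_basis_variance//.
have /andP[x0 x1] := cx i.
apply: ler_pM; [by apply: mulr_ge0; lra|by rewrite invr_ge0| by nra|].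
by rewrite lef_pV2 ?posrE ?ltr0n// ler_nat.
Qed.

End BernsteinWeights.

(** * Uniform convergence in capacity *)

(** Each term is either below the threshold [a] or bounded by [b], hence at most
    [a + b] times the indicator of its being above the threshold. *)
Lemma convex_sum_threshold {R : realType} {K : finType} {p g : K -> R}
    (a b : R) :
  0 <= a -> (forall k, 0 <= p k) -> \sum_k p k = 1 ->
  (forall k, `|g k| <= b) ->
  `|\sum_k p k * g k| <= a + b * \sum_(k | a <= `|g k|) p k.
Proof.
move=> a0 p0 p1 gb; apply: le_trans (ler_norm_sum _ _ _) _.
have -> : a = \sum_k p k * a by rewrite -mulr_suml p1 mul1r.
rewrite mulr_sumr [X in _ + X]big_mkcond/= -big_split/=.
rewrite -mulr_suml p1 mul1r.
apply: ler_sum => k _; rewrite normrM ger0_norm//; case: ifPn => [_|].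
  by rewrite [b * _]mulrC -mulrDr ler_wpM2l// ler_wpDl.
by rewrite -ltNge addr0 => /ltW; exact: ler_wpM2l.
Qed.

Theorem theorem3 (R : realType) (d : measure_display) (T : measurableType d)
    (mu : set T -> R) (N : nat) (F : 'rV[R]_N -> T -> R) (M : R) (E : set T)
    (N_gt0 : (0 < N)%N)
    (mu_capacity : capacity mu)
    (mu_submodular : submodular mu)
    (F_random : random_function (unit_cube R N) F)
    (F_continuous : forall x, unit_cube R N x ->
      continuous_in_capacity_at mu (unit_cube R N) F x)
    (E_measurable : measurable E)
    (muE0 : mu E = 0)
    (F_bounded : forall w, ~ E w ->
      (ereal_sup [set (`|F x w|)%:E | x in unit_cube R N] <= M%:E)%E) :
  forall eps eta : R, 0 < eps -> 0 < eta ->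
    exists n0 : nat, forall x : 'rV[R]_N, unit_cube R N x ->
      forall n : 'I_N -> nat,
        (forall i, (0 < n i)%N) -> (forall i, (n0 <= n i)%N) ->
        mu [set w | eps <= `|random_bernstein n F x w - F x w|] < eta.
Proof.
move=> eps eta eps0 eta0.
pose L : R := `|M| + 1; have L0 : 0 < L by rewrite /L ltr_wpDl.
have FL w x : ~ E w -> unit_cube R N x -> `|F x w| <= L.
  move=> Ew cx; rewrite -lee_fin; apply: (@le_trans _ _ M%:E).
    by apply: le_trans (F_bounded w Ew); apply: ereal_sup_ubound; exists x.
  by rewrite lee_fin /L; have := ler_norm M; lra.
pose c := eps / (4 * L); have c0 : 0 < c by rewrite divr_gt0// mulr_gt0.
have ceta0 : 0 < c * eta / 4 by rewrite divr_gt0// mulr_gt0.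
(* The Markov inequality divides by [c], so [c * eta] has to be reached; half of
   it is shared between the grid points near [x] and those far from it. *)
have [dl dl0 hdl] := continuous_in_capacity_uniformly mu_capacity mu_submodular
  F_random F_continuous _ _ (divr_gt0 eps0 (ltr0Sn R 1)) ceta0.
pose n0 := (Num.truncn (N%:R / (dl ^+ 2 * (c * eta / 4)))).+1.
have hn0 : N%:R / n0%:R < dl ^+ 2 * (c * eta / 4).
  rewrite ltr_pdivrMr ?ltr0n// mulrC -ltr_pdivrMr; last first.
    by rewrite mulr_gt0 ?exprn_gt0.
  exact: truncnS_gt.
exists n0; move=> x cx n npos nn0.
pose p := bernstein_weight n x.
pose y k : 'rV[R]_N := bernstein_node n k.
have p0 k : 0 <= p k by exact: bernstein_weight_ge0.
have mF k : measurable_fun [set: T] (F (y k)).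
  by apply: F_random; exact: bernstein_node_cube.
pose A k := [set w | eps / 2 <= `|F (y k) w - F x w|].
have mA k : measurable (A k).
  by apply: measurable_deviation => //; exact: F_random.
pose D := [set w | eps <= `|random_bernstein n F x w - F x w|].
have mD : measurable D.
  apply: measurable_deviation; last exact: F_random.
  apply: measurable_sum => k.
  by apply: measurable_funM; [exact: measurable_cst|exact: (mF k)].
have large w : (D `\` E) w -> c <= \sum_(k | w \in A k) p k.
  move=> [Dw Ew]; set s := \sum_(k | _) _.
  have : eps <= eps / 2 + 2 * L * s.
    have -> : s = \sum_(k | eps / 2 <= `|F (y k) w - F x w|) p k.
      by apply: eq_bigl => k; apply/idP/idP => [/set_mem|/mem_set].
    apply: le_trans Dw _.
    have -> : random_bernstein n F x w - F x w =
        \sum_k p k * (F (y k) w - F x w).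
      under [RHS]eq_bigr do rewrite mulrBr.
      by rewrite sumrB -mulr_suml sum_bernstein_weight mul1r.
    apply: convex_sum_threshold => // [||k].
    - by rewrite divr_ge0 ?ltW.
    - exact: sum_bernstein_weight.
    apply: le_trans (ler_normB _ _) _.
    have := FL w _ Ew (bernstein_node_cube k); have := FL w _ Ew cx.
    by rewrite -/(y k); lra.
  move=> hs; rewrite /c ler_pdivrMr; [nra|by rewrite mulr_gt0].
(* Chebyshev's argument: the second term is at least [1] at the far points. *)
have mA_le k :
    mu (A k) <= c * eta / 4 + (\sum_i (y k ord0 i - x ord0 i) ^+ 2) / dl ^+ 2.
  have sq0 : 0 <= \sum_i (y k ord0 i - x ord0 i) ^+ 2.
    by apply: sumr_ge0 => i _; exact: sqr_ge0.
  have [near_x|] := pselect (forall i, `|y k ord0 i - x ord0 i| < dl).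
    apply: ler_wpDr; first by rewrite divr_ge0 ?sqr_ge0.
    by apply: ltW; apply: hdl => //; exact: bernstein_node_cube.
  move=> /existsNP[i /negP]; rewrite -leNgt => far.
  apply: le_trans (capacity_le1 mu_capacity (mA k)) _.
  apply: ler_wpDl; first exact: ltW.
  rewrite ler_pdivlMr ?exprn_gt0// mul1r (bigD1 i)//=; apply: ler_wpDr.
    by apply: sumr_ge0 => j _; exact: sqr_ge0.
  by rewrite -[leRHS]real_normK ?num_real// lerXn2r ?nnegrE// ltW.
have sum_le : \sum_k p k * mu (A k) < c * eta / 2.
  apply: (@le_lt_trans _ _ (c * eta / 4 + N%:R / n0%:R / dl ^+ 2)).
    apply: (@le_trans _ _ (\sum_k (p k * (c * eta / 4) +
       p k * (\sum_i (y k ord0 i - x ord0 i) ^+ 2) / dl ^+ 2))).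
      by apply: ler_sum => k _; rewrite -[p k * _ / _]mulrA -mulrDr ler_wpM2l.
    rewrite big_split/= -!mulr_suml sum_bernstein_weight mul1r lerD2l.
    rewrite ler_wpM2r ?invr_ge0 ?sqr_ge0//.
    exact: bernstein_weight_variance.
  have : N%:R / n0%:R / dl ^+ 2 < c * eta / 4.
    by rewrite ltr_pdivrMr ?exprn_gt0// [ltRHS]mulrC.
  by lra.
have mDE : measurable (D `\` E) by exact: measurableD.
have := submodular_markov mu_capacity mu_submodular
  p0 mA mDE (ltW c0) large.
have : mu D <= mu (D `\` E) + mu E.
  apply: le_trans
    (submodular_capacityU mu_capacity mu_submodular mDE E_measurable).
  apply: (capacity_le mu_capacity) => //; first exact: measurableU.
  by move=> w Dw; have [Ew|Ew] := pselect (E w); [right|left].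
rewrite muE0 addr0 -/D => DE markov.
suff : c * mu D < c * eta by rewrite ltr_pM2l.
have : c * mu D <= c * mu (D `\` E) by rewrite ler_pM2l.
have : 0 < c * eta by rewrite mulr_gt0.
by lra.
Qed.
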